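(* The round $3$-sphere $\mathbb{S}^3$ carries generalized Killing spinors which are not Killing spinors.
   Context: On a Riemannian spin manifold $(M,g)$, $\Sigma M$ denotes the spinor bundle, regarded as a real vector bundle, with the connection $\nabla$ induced by the Levi-Civita connection, a $\nabla$-parallel Euclidean product $\langle\cdot,\cdot\rangle$, and Clifford multiplication by tangent vectors, which is skew-symmetric with $X\cdot Y+Y\cdot X=-2g(X,Y)$. In dimension $3$, $\Sigma M$ has real rank $4$ (the usual complex spinor bundle of complex rank $2$), with the convention that the Clifford action of the volume form is the identity. A generalized Killing spinor is a non-zero section $\Psi$ of $\Sigma M$ such that $\nabla_X\Psi=A(X)\cdot\Psi$ for all vector fields $X$, where $A$ is some $g$-symmetric endomorphism field of $\mathrm{T}M$. It is a Killing spinor if $A$ is a non-zero real constant multiple of the identity. *)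

(* Defs.v *)
From mathcomp Require Import all_boot all_order all_algebra.
From mathcomp Require Import all_classical all_reals all_analysis.
From mathcomp Require Import ring.

Set Implicit Arguments.
Unset Strict Implicit.
Unset Printing Implicit Defensive.

Import Order.TTheory GRing.Theory Num.Theory numFieldNormedType.Exports.
Local Open Scope classical_set_scope.
Local Open Scope ring_scope.

(* The norm that the library puts on 'rV[R]_n is the sup norm; the round sphere
   needs the Euclidean inner product. *)
Definition dot {R : realType} {n : nat} (v w : 'rV[R]_n) : R :=
  \sum_(i < n) v 0 i * w 0 i.

(* f is C^k on the open set U: f is continuous on U and, for k > 0,
   differentiable at every point of U with all directional derivatives
   C^(k-1) on U. *)
Fixpoint Ck_on {R : realType} {V W : normedModType R} (k : nat) (U : set V)
    (f : V -> W) {struct k} : Prop :=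
  (forall x, U x -> {for x, continuous f}) /\
  match k with
  | 0%N => True
  | k'.+1 => (forall x, U x -> differentiable f x) /\
             (forall v : V, Ck_on k' U (fun x => 'd f x v))
  end.

Definition smooth_on {R : realType} {V W : normedModType R} (U : set V)
  (f : V -> W) : Prop := forall k, Ck_on k U f.

(* R^4 is identified with the quaternions, (a, b, c, d) = a + bi + cj + dk. *)
Definition quat {R : realType} (a b c d : R) : 'rV[R]_4 :=
  \row_(i < 4) [:: a; b; c; d]`_i.

Definition qmul {R : realType} (p q : 'rV[R]_4) : 'rV[R]_4 :=
  quat (p 0 0 * q 0 0 - p 0 1 * q 0 1 - p 0 2 * q 0 2 - p 0 3 * q 0 3)
       (p 0 0 * q 0 1 + p 0 1 * q 0 0 + p 0 2 * q 0 3 - p 0 3 * q 0 2)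
       (p 0 0 * q 0 2 - p 0 1 * q 0 3 + p 0 2 * q 0 0 + p 0 3 * q 0 1)
       (p 0 0 * q 0 3 + p 0 1 * q 0 2 - p 0 2 * q 0 1 + p 0 3 * q 0 0).

(* qimag 0, qimag 1, qimag 2 are the units i, j, k. *)
Definition qimag {R : realType} (a : 'I_3) : 'rV[R]_4 :=
  delta_mx 0 (lift ord0 a).

Definition sphere (R : realType) : Type := {x : 'rV[R]_4 | dot x x == 1}.

Lemma pole_subproof (R : realType) :
  dot (quat 1 0 0 0 : 'rV[R]_4) (quat 1 0 0 0) == 1.
Proof.
by apply/eqP; rewrite /dot !big_ord_recl big_ord0 !mxE /= mulr1 !mulr0 !addr0.
Qed.

Definition pole (R : realType) : sphere R :=
  exist (fun x : 'rV[R]_4 => is_true (dot x x == 1)) _ (pole_subproof R).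

(* The radial retraction R^4 \ {0} -> S^3, x |-> x / |x|; its value at 0 is
   irrelevant. *)
Definition rad {R : realType} (x : 'rV[R]_4) : sphere R :=
  insubd (pole R) ((Num.sqrt (dot x x))^-1 *: x).

(* As rad is a smooth retraction of R^4 \ {0} onto S^3, a map F on S^3 is
   smooth if and only if F \o rad is smooth on R^4 \ {0}. *)
Definition smooth_S3 {R : realType} {W : normedModType R} (F : sphere R -> W)
  : Prop := smooth_on [set x : 'rV[R]_4 | x != 0] (F \o rad).

Definition tangent {R : realType} (x : sphere R) (v : 'rV[R]_4) : Prop :=
  dot v (val x) = 0.

Definition vector_field {R : realType} (X : sphere R -> 'rV[R]_4) : Prop :=
  smooth_S3 X /\ forall x, tangent x (X x).

(* Derivative at x, in the direction of the tangent vector v, of a map on S^3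
   with values in a fixed vector space: the curve rad (x + t v) of S^3 has
   velocity v at t = 0. *)
Definition deriv_S3 {R : realType} {W : normedModType R} (F : sphere R -> W)
  (x : sphere R) (v : 'rV[R]_4) : W := 'D_v (F \o rad) (val x).

(* Levi-Civita connection of the round metric, i.e. of the metric induced by
   R^4: the tangential part of the ambient derivative. *)
Definition levi_civita {R : realType} (x : sphere R) (v : 'rV[R]_4)
    (Y : sphere R -> 'rV[R]_4) : 'rV[R]_4 :=
  let w := deriv_S3 Y x v in w - dot w (val x) *: val x.

(* The global orthonormal frame x i, x j, x k of T S^3. S^3 is simply connected,
   so its spin structure is unique; it is the trivial one determined by this
   frame, and the spinor bundle is S^3 x Sigma_3, with Sigma_3 the spin
   representation. *)
Definition frame {R : realType} (a : 'I_3) (x : sphere R) : 'rV[R]_4 :=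
  qmul (val x) (qimag a).

(* Sigma_3 as a real space of rank 4: the quaternions, on which the a-th basis
   vector of R^3 acts by left multiplication by -i, -j, -k. The complex
   structure, which is not needed, is right multiplication by i. The minus
   signs make the volume form act as +1, since (-i)(-j)(-k) = 1. *)
Definition gamma {R : realType} (a : 'I_3) (psi : 'rV[R]_4) : 'rV[R]_4 :=
  - qmul (qimag a) psi.

(* Clifford product v . psi of a tangent vector v at x with a spinor at x. *)
Definition clifford {R : realType} (x : sphere R) (v psi : 'rV[R]_4)
  : 'rV[R]_4 := \sum_(a < 3) dot v (frame a x) *: gamma a psi.

(* Connection of the spinor bundle induced by the Levi-Civita connection, in
   the trivialization given by an orthonormal frame (e_a):
     nabla_v Psi = d Psi (v)
        + 1/4 sum_(a, b) g (nabla_v e_a, e_b) e_a . e_b . Psi. *)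
Definition spin_nabla {R : realType} (x : sphere R) (v : 'rV[R]_4)
    (Psi : sphere R -> 'rV[R]_4) : 'rV[R]_4 :=
  deriv_S3 Psi x v +
  4^-1 *: \sum_(a < 3) \sum_(b < 3)
     dot (levi_civita x v (frame a)) (frame b x) *:
       clifford x (frame a x) (clifford x (frame b x) (Psi x)).

(* A g-symmetric endomorphism field of T S^3: A x acts on the tangent space at
   x by v |-> v *m A x. The values of A x on the normal line are unconstrained
   and never used. *)
Record symmetric_endo_field {R : realType} (A : sphere R -> 'M[R]_4) : Prop :=
  SymmetricEndoField {
    endo_smooth : smooth_S3 A;
    endo_tangent : forall x v, tangent x v -> tangent x (v *m A x);
    endo_symmetric : forall x v w, tangent x v -> tangent x w ->
      dot (v *m A x) w = dot v (w *m A x) }.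

Definition generalized_killing_for {R : realType} (A : sphere R -> 'M[R]_4)
    (Psi : sphere R -> 'rV[R]_4) : Prop :=
  [/\ smooth_S3 Psi, exists x, Psi x != 0, symmetric_endo_field A &
      forall X, vector_field X -> forall x,
        spin_nabla x (X x) Psi = clifford x (X x *m A x) (Psi x)].

Definition generalized_killing_spinor {R : realType}
    (Psi : sphere R -> 'rV[R]_4) : Prop :=
  exists A, generalized_killing_for A Psi.

Definition killing_spinor {R : realType} (Psi : sphere R -> 'rV[R]_4) : Prop :=
  exists2 A, generalized_killing_for A Psi &
    exists2 lambda : R, lambda != 0 &
      forall x v, tangent x v -> v *m A x = lambda *: v.

Lemma dot4E (R : realType) (v w : 'rV[R]_4) :
  dot v w = v 0 0 * w 0 0 + v 0 1 * w 0 1 + v 0 2 * w 0 2 + v 0 3 * w 0 3.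
Proof.
rewrite /dot !big_ord_recl big_ord0 addr0 !addrA.
by congr (_ * _ + _ * _ + _ * _ + _ * _); congr (_ 0 _); apply/val_inj.
Qed.

Lemma quat0 (R : realType) (a b c d : R) : quat a b c d 0 0 = a.
Proof. by rewrite mxE. Qed.
Lemma quat1 (R : realType) (a b c d : R) : quat a b c d 0 1 = b.
Proof. by rewrite mxE. Qed.
Lemma quat2 (R : realType) (a b c d : R) : quat a b c d 0 2 = c.
Proof. by rewrite mxE. Qed.
Lemma quat3 (R : realType) (a b c d : R) : quat a b c d 0 3 = d.
Proof. by rewrite mxE. Qed.
Definition quatE := (quat0, quat1, quat2, quat3).

Lemma quat_eqP (R : realType) (p q : 'rV[R]_4) :
  p 0 0 = q 0 0 -> p 0 1 = q 0 1 -> p 0 2 = q 0 2 -> p 0 3 = q 0 3 -> p = q.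
Proof.
move=> h0 h1 h2 h3; apply/rowP; case=> -[|[|[|[|//]]]] lti.
- by rewrite (_ : Ordinal lti = 0) //; apply/val_inj.
- by rewrite (_ : Ordinal lti = 1) //; apply/val_inj.
- by rewrite (_ : Ordinal lti = 2) //; apply/val_inj.
- by rewrite (_ : Ordinal lti = 3) //; apply/val_inj.
Qed.

Lemma frame_tangent (R : realType) a (x : sphere R) : tangent x (frame a x).
Proof.
rewrite /tangent dot4E /frame /qmul !quatE.
by case: a => -[|[|[|//]]] lta; rewrite /qimag !mxE /=; ring.
Qed.

Lemma frame_orthonormal (R : realType) a b (x : sphere R) :
  dot (frame a x) (frame b x) = (a == b)%:R.
Proof.
have /eqP := valP x; rewrite dot4E => x1.
rewrite dot4E /frame /qmul !quatE.
case: a b => -[|[|[|//]]] lta [[|[|[|//]]] ltb]; rewrite /qimag !mxE /=;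
  (try (by ring)); rewrite -[RHS]x1; by ring.
Qed.

Lemma gammaE (R : realType) (psi : 'rV[R]_4) :
  [/\ gamma 0 psi = quat (psi 0 1) (- psi 0 0) (psi 0 3) (- psi 0 2),
      gamma 1 psi = quat (psi 0 2) (- psi 0 3) (- psi 0 0) (psi 0 1) &
      gamma 2 psi = quat (psi 0 3) (psi 0 2) (- psi 0 1) (- psi 0 0)].
Proof.
by split; rewrite /gamma /qmul /qimag !mxE /=; apply: quat_eqP;
   rewrite ?(mxE, quatE) /= ?(mul0r, mul1r, add0r, addr0, subr0, opprB, opprK,
     opprD, oppr0) // ?(add0r, addr0, opprK).
Qed.

Lemma ord3P (P : 'I_3 -> Prop) : P 0 -> P 1 -> P 2 -> forall a, P a.
Proof.
move=> h0 h1 h2; case=> -[|[|[|//]]] lta.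
- by rewrite (_ : Ordinal lta = 0) //; apply/val_inj.
- by rewrite (_ : Ordinal lta = 1) //; apply/val_inj.
- by rewrite (_ : Ordinal lta = 2) //; apply/val_inj.
Qed.

Lemma gammaK (R : realType) (a : 'I_3) (psi : 'rV[R]_4) :
  gamma a (gamma a psi) = - psi.
Proof.
have E0 (p : 'rV[R]_4) := let: And3 h _ _ := gammaE p in h.
have E1 (p : 'rV[R]_4) := let: And3 _ h _ := gammaE p in h.
have E2 (p : 'rV[R]_4) := let: And3 _ _ h := gammaE p in h.
elim/ord3P: a; rewrite !(E0, E1, E2);
  by apply: quat_eqP; rewrite !quatE [RHS]mxE ?opprK.
Qed.

Lemma gamma_anticomm (R : realType) (a b : 'I_3) (psi : 'rV[R]_4) :
  a != b -> gamma a (gamma b psi) = - gamma b (gamma a psi).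
Proof.
have E0 (p : 'rV[R]_4) := let: And3 h _ _ := gammaE p in h.
have E1 (p : 'rV[R]_4) := let: And3 _ h _ := gammaE p in h.
have E2 (p : 'rV[R]_4) := let: And3 _ _ h := gammaE p in h.
elim/ord3P: a; elim/ord3P: b => // _; rewrite !(E0, E1, E2);
  by apply: quat_eqP; rewrite [RHS]mxE !quatE ?opprK.
Qed.

Lemma clifford_frame (R : realType) (a : 'I_3) (x : sphere R) psi :
  clifford x (frame a x) psi = gamma a psi.
Proof.
rewrite /clifford (bigD1 a) //= frame_orthonormal eqxx scale1r big1 ?addr0 //.
by move=> b ba; rewrite frame_orthonormal eq_sym (negbTE ba) scale0r.
Qed.

Lemma clifford_vol (R : realType) (x : sphere R) psi :
  clifford x (frame 0 x) (clifford x (frame 1 x) (clifford x (frame 2 x) psi))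
  = psi.
Proof.
have [E0 _ _] := gammaE (gamma 1 (gamma 2 psi)).
have [_ E1 _] := gammaE (gamma 2 psi).
have [_ _ E2] := gammaE psi.
by rewrite !clifford_frame E0 E1 E2; apply: quat_eqP; rewrite !quatE ?opprK.
Qed.

Lemma gamma_skew (R : realType) (a : 'I_3) (phi psi : 'rV[R]_4) :
  dot (gamma a phi) psi = - dot phi (gamma a psi).
Proof.
have E0 (p : 'rV[R]_4) := let: And3 h _ _ := gammaE p in h.
have E1 (p : 'rV[R]_4) := let: And3 _ h _ := gammaE p in h.
have E2 (p : 'rV[R]_4) := let: And3 _ _ h := gammaE p in h.
by elim/ord3P: a; rewrite !(E0, E1, E2) !dot4E !quatE; ring.
Qed.

Lemma val_rad (R : realType) (x : 'rV[R]_4) : x != 0 ->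
  val (rad x) = (Num.sqrt (dot x x))^-1 *: x.
Proof.
move=> x0; rewrite /rad val_insubd ifT //.
have ge0 : 0 <= dot x x by apply: sumr_ge0 => i _; rewrite -expr2 sqr_ge0.
have n0 : dot x x != 0.
  apply: contra x0 => /eqP d0; apply/eqP/rowP => i; rewrite mxE; apply/eqP.
  have /allP/(_ i) : all (fun j => x 0 j * x 0 j == 0) (index_enum 'I_4).
    move: d0; rewrite /dot => /eqP; rewrite psumr_eq0 //.
    by move=> j _; rewrite -expr2 sqr_ge0.
  by rewrite mem_index_enum => /(_ isT); rewrite mulf_eq0 orbb.
rewrite /dot (eq_bigr (fun i => (Num.sqrt (dot x x))^-1 ^+ 2 * (x 0 i * x 0 i))).
  by rewrite -mulr_sumr exprVn sqr_sqrtr // mulVf.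
by move=> i _; rewrite !mxE expr2; ring.
Qed.

Lemma radK (R : realType) (x : sphere R) : rad (val x) = x.
Proof.
have /eqP x1 := valP x; apply: val_inj; rewrite val_rad.
  by rewrite x1 sqrtr1 invr1 scale1r.
apply/eqP => x0; move: x1; rewrite x0 /dot big1 => [/eqP|i _].
  by rewrite eq_sym oner_eq0.
by rewrite mxE mul0r.
Qed.

(* Main.v *)
(** Identify S^3 with the unit quaternions. In the frame x i, x j, x k the spin
connection is nabla_v = d_v - (1/2) v., so constant spinors are Killing. The
spinor Psi x = conj(x) i x, i.e. the Hopf map, satisfies
nabla_v Psi = A(v) . Psi with A(v) = (3/2) v - 2 <v, xi> xi, where xi = i x is
the Hopf field. Clifford multiplication by a non-zero tangent vector kills no
non-zero spinor, so A is determined by Psi; as it has the two eigenvalues -1/2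
and 3/2, Psi is not a Killing spinor. *)

Require Import Defs.
From mathcomp Require Import all_boot all_order all_algebra.
From mathcomp Require Import all_classical all_reals all_analysis.
From mathcomp Require Import ring.

Set Implicit Arguments.
Unset Strict Implicit.
Unset Printing Implicit Defensive.

Import Order.TTheory GRing.Theory Num.Theory numFieldNormedType.Exports.
Local Open Scope classical_set_scope.
Local Open Scope ring_scope.

(** * Calculus of $C^k$ maps on open sets *)

Section Smooth.
Context {R : realType} {V : normedModType R}.
Implicit Types (W : normedModType R) (U : set V) (k : nat).

(** Only the germ matters: the first-order expansion of [f] at [x] is also one of [g], and
    uniqueness of the differential identifies ['d g x] with ['d f x]. *)
Lemma near_eq_differentiable W (f g : V -> W) (x : V) :
  (\near x, f x = g x) -> differentiable f x -> differentiable g x.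
Proof.
move=> fg /diff_locallyP[dfc] /eqaddoP fo.
have gfx : g x = f x by rewrite (nbhs_singleton fg).
suff go : g \o shift x = cst (g x) + 'd f x +o_ 0 id.
  by apply/diff_locallyP; rewrite (diff_unique dfc go).
apply/eqaddoP => e e0; have := fo _ e0.
apply: filter_app; near=> h.
suff -> : (f \o shift x - (cst (f x) + 'd f x)) h =
          (g \o shift x - (cst (g x) + 'd f x)) h by [].
suff fgh : f (h + x) = g (h + x) by rewrite /= !fctE /= gfx fgh.
near: h; move: fg; rewrite (near_shift 0).
by apply: filterS => h; rewrite /= subr0.
Unshelve. all: by end_near. Qed.

(** As [U] is open, agreement on [U] is agreement near each of its points and passes to directional
    derivatives. This allows derivative formulas that hold only on [U] to be substituted below. *)
Lemma eq_Ck_on W k U (f g : V -> W) : open U -> {in U, f =1 g} ->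
  Ck_on k U f -> Ck_on k U g.
Proof.
move=> oU; elim: k f g => [|k IH] f g fg /= [fc fd].
  split=> // x Ux; rewrite /prop_for /continuous_at -fg ?inE//.
  apply: cvg_trans (fc x Ux); apply: near_eq_cvg.
  by near=> y; apply: fg; rewrite inE; near: y; exact: open_nbhs_nbhs.
have nfg x : U x -> \near x, f x = g x.
  move=> Ux; near=> y; apply: fg; rewrite inE; near: y.
  exact: open_nbhs_nbhs.
case: fd => fd fD.
have gd x : U x -> differentiable g x.
  by move=> Ux; apply: near_eq_differentiable (nfg _ Ux) (fd _ Ux).
split; [|split] => //; first by move=> x /gd /differentiable_continuous.
move=> v; apply: IH (fD v) => x; rewrite inE => Ux.
by rewrite -!deriveE; [exact: near_eq_derive (nfg _ Ux)
                     | exact: gd | exact: fd].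
Unshelve. all: by end_near. Qed.

Lemma Ck_onS W k U (f : V -> W) : Ck_on k.+1 U f -> Ck_on k U f.
Proof.
elim: k f => [|k IH] f /= [fc [fd fD]]; first by split.
by split=> //; split=> // v; exact/IH/fD.
Qed.

Lemma Ck_on_cst W k U (a : W) : Ck_on k U (cst a).
Proof.
elim: k a => [|k IH] a /=; first by split=> // x _; exact: cst_continuous.
split; first by move=> x _; exact: cst_continuous.
split=> [x _|v]; first exact: differentiable_cst.
under eq_fun do rewrite diff_cst.
exact: IH.
Qed.

Lemma Ck_onD W k U (f g : V -> W) :
  open U -> Ck_on k U f -> Ck_on k U g -> Ck_on k U (fun x => f x + g x).
Proof.
move=> oU; elim: k f g => [|k IH] f g /= [fc fd] [gc gd].
  by split=> // x Ux; apply: cvgD; [exact: fc|exact: gc].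
case: fd gd => fd fD [gd gD].
split; first by move=> x Ux; apply: cvgD; [exact: fc|exact: gc].
split=> [x Ux|v]; first exact: differentiableD (fd _ Ux) (gd _ Ux).
apply: eq_Ck_on (IH _ _ (fD v) (gD v)) => // x; rewrite inE => Ux.
by rewrite [in RHS](diffD (fd _ Ux) (gd _ Ux)).
Qed.

(** The Leibniz rule brings back [f] and [g] undifferentiated, so the induction also uses them at
    order [k], by [Ck_onS]. *)
Lemma Ck_onM k U (f g : V -> R) :
  open U -> Ck_on k U f -> Ck_on k U g -> Ck_on k U (fun x => f x * g x).
Proof.
move=> oU; elim: k f g => [|k IH] f g hf hg.
  case: hf hg => fc _ [gc _].
  by split=> // x Ux; apply: cvgM; [exact: fc|exact: gc].
have [f' g'] := (Ck_onS hf, Ck_onS hg).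
case: hf hg => fc [fd fD] [gc [gd gD]].
split; first by move=> x Ux; apply: cvgM; [exact: fc|exact: gc].
split=> [x Ux|v]; first exact: differentiableM (fd _ Ux) (gd _ Ux).
apply: eq_Ck_on (Ck_onD oU (IH _ _ f' (gD v)) (IH _ _ g' (fD v))) => // x.
by rewrite inE => Ux; rewrite [in RHS](diffM (fd _ Ux) (gd _ Ux)).
Qed.

(** The differential $-f^{-2}\,df$ is a product of $df$ and copies of $f^{-1}$, the latter being
    $C^k$ by induction. *)
Lemma Ck_onV k U (f : V -> R) : open U -> (forall x, U x -> f x != 0) ->
  Ck_on k U f -> Ck_on k U (fun x => (f x)^-1).
Proof.
move=> oU f0; elim: k => [|k IH] hf.
  by case: hf => fc _; split=> // x Ux; apply: cvgV; [exact: f0|exact: fc].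
have hV := IH (Ck_onS hf).
case: hf => fc [fd fD].
split; first by move=> x Ux; apply: cvgV; [exact: f0|exact: fc].
split=> [x Ux|v]; first exact: differentiableV (fd _ Ux) (f0 _ Ux).
apply: (@eq_Ck_on _ _ _ 
  (fun x => (-1 * ((f x)^-1 * (f x)^-1)) * 'd f x v)) => //.
  move=> x; rewrite inE => Ux; rewrite [in RHS](diffV (fd _ Ux) (f0 _ Ux)) /=.
  by rewrite mulN1r -invfM -expr2.
exact: Ck_onM oU (Ck_onM oU (Ck_on_cst k U (-1 : R)) (Ck_onM oU hV hV)) (fD v).
Qed.

Lemma Ck_onZl W k U (f : V -> R) (w : W) :
  open U -> Ck_on k U f -> Ck_on k U (fun x => f x *: w).
Proof.
move=> oU; elim: k f => [|k IH] f /= [fc fd].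
  by split=> // x Ux; apply: cvgZr_tmp; exact: fc.
case: fd => fd fD.
split; first by move=> x Ux; apply: cvgZr_tmp; exact: fc.
split=> [x Ux|v]; first exact: differentiableZl (fd _ Ux).
apply: eq_Ck_on (IH _ (fD v)) => // x; rewrite inE => Ux.
by rewrite [in RHS](diffZl w (fd _ Ux)).
Qed.

Lemma Ck_on_mx m n k U (f : V -> 'M[R]_(m, n)) : open U ->
  (forall i j, Ck_on k U (fun x => f x i j)) -> Ck_on k U f.
Proof.
move=> oU hf.
have hsum (W : normedModType R) I (r : seq I) (F : I -> V -> W) :
    (forall i, Ck_on k U (F i)) -> Ck_on k U (fun x => \sum_(i <- r) F i x).
  move=> hF; elim: r => [|i r IHr].
    by apply: eq_Ck_on (Ck_on_cst k U 0) => // x _; rewrite big_nil.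
  apply: eq_Ck_on (Ck_onD oU (hF i) IHr) => // x _; by rewrite big_cons.
apply: (@eq_Ck_on _ _ _
  (fun x => \sum_(i < m) \sum_(j < n) f x i j *: delta_mx i j)) => //.
  by move=> x _; rewrite -matrix_sum_delta.
by apply: (hsum) => i; apply: (hsum) => j; apply: Ck_onZl.
Qed.

End Smooth.

(** * Coordinates, quaternion-valued maps and radial factors on $\mathbb{R}^4$ *)

(** Made an instance below, so that [is_derive_eq] differentiates polynomials in the coordinates. *)
Lemma derive_coord (R : realType) m n (x v : 'M[R]_(m, n)) i j :
  is_derive x v (fun y : 'M[R]_(m, n) => y i j : R) (v i j).
Proof.
apply: DeriveDef; first exact/diff_derivable/differentiable_coord.
have /derive_mx : derivable (@id 'M[R]_(m, n)) x v by exact: derivable_id.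
rewrite derive_id => /matrixP/(_ i j).
by rewrite mxE => <-.
Qed.

Lemma Ck_on_coord (R : realType) m n k (U : set 'M[R]_(m, n)) i j : open U ->
  Ck_on k U (fun y => y i j : R).
Proof.
move=> oU; case: k => [|k]; first by split=> // x _; exact: coord_continuous.
split; first by move=> x _; exact: coord_continuous.
split=> [x _|v]; first exact: differentiable_coord.
apply: eq_Ck_on (Ck_on_cst k U (v i j)) => // x _.
rewrite -deriveE; last exact: differentiable_coord.
by rewrite (@derive_val _ _ _ _ _ _ _ (derive_coord x v i j)).
Qed.

#[local] Existing Instance derive_coord.

Lemma ord4P (P : 'I_4 -> Prop) : P 0 -> P 1 -> P 2 -> P 3 -> forall a, P a.
Proof.
move=> h0 h1 h2 h3; case=> -[|[|[|[|//]]]] lta.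
- by rewrite (_ : Ordinal lta = 0) //; apply/val_inj.
- by rewrite (_ : Ordinal lta = 1) //; apply/val_inj.
- by rewrite (_ : Ordinal lta = 2) //; apply/val_inj.
- by rewrite (_ : Ordinal lta = 3) //; apply/val_inj.
Qed.

Section RadialMaps.
Context {R : realType}.
Implicit Types (x y v w : 'rV[R]_4).

Lemma Ck_onN (V : normedModType R) k (U : set V) (f : V -> R) : open U ->
  Ck_on k U f -> Ck_on k U (fun z => - f z).
Proof.
move=> oU hf; apply: eq_Ck_on (Ck_onM oU (Ck_on_cst k U (-1 : R)) hf) => // z _.
by rewrite mulN1r.
Qed.

Lemma open_neq0 : open [set x : 'rV[R]_4 | x != 0].
Proof.
rewrite (_ : [set _ | _] = ~` [set 0]).
  rewrite openC.
  exact/accessible_closed_set1/hausdorff_accessible/norm_hausdorff.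
by apply/seteqP; split=> x /= /eqP.
Qed.

Lemma dot_gt0 x : x != 0 -> 0 < dot x x.
Proof.
move=> x0; rewrite lt_def sumr_ge0 => [|i _]; last by rewrite -expr2 sqr_ge0.
rewrite andbT; apply: contra x0; rewrite psumr_eq0 => [|i _]; last first.
  by rewrite -expr2 sqr_ge0.
move=> /allP h; apply/eqP/rowP => i; rewrite mxE; apply/eqP.
by have := h i (mem_index_enum i); rewrite /= mulf_eq0 orbb.
Qed.

Lemma sphere_neq0 (x : sphere R) : val x != 0.
Proof.
apply: contraTneq (valP x) => ->.
by rewrite /dot big1 ?(eq_sym 0) ?oner_eq0// => i _; rewrite mxE mul0r.
Qed.

Lemma Ck_on_quat k (U : set 'rV[R]_4) (a b c d : 'rV[R]_4 -> R) : open U ->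
  Ck_on k U a -> Ck_on k U b -> Ck_on k U c -> Ck_on k U d ->
  Ck_on k U (fun y => quat (a y) (b y) (c y) (d y)).
Proof.
move=> oU ha hb hc hd; apply: Ck_on_mx => // i j; rewrite ord1.
by elim/ord4P: j; under eq_fun do rewrite quatE.
Qed.

Lemma derive_quat x v (a b c d : 'rV[R]_4 -> R) a' b' c' d' :
  is_derive x v a a' -> is_derive x v b b' ->
  is_derive x v c c' -> is_derive x v d d' ->
  is_derive x v (fun y => quat (a y) (b y) (c y) (d y)) (quat a' b' c' d').
Proof.
move=> [ha <-] [hb <-] [hc <-] [hd <-].
have h : derivable (fun y => quat (a y) (b y) (c y) (d y)) x v.
  apply/derivable_mxP => i j; rewrite ord1.
  pose D (f : 'rV[R]_4 -> R) := derivable f x v.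
  by elim/ord4P: j; [apply: (eq_ind a D ha) | apply: (eq_ind b D hb)
    | apply: (eq_ind c D hc) | apply: (eq_ind d D hd)];
    apply/funext => y; rewrite quatE.
apply: DeriveDef => //; rewrite (derive_mx h); apply/rowP.
by elim/ord4P; rewrite mxE quatE; under eq_fun do rewrite quatE.
Qed.

Lemma sqr_dotE : (fun y => dot y y) = (fun y =>
  y 0 0 * y 0 0 + y 0 1 * y 0 1 + y 0 2 * y 0 2 + y 0 3 * y 0 3).
Proof. by apply/funext => y; rewrite dot4E. Qed.

Lemma derive_dot x v : is_derive x v (fun y => dot y y) (2 * dot v x).
Proof.
rewrite sqr_dotE; apply: is_derive_eq; rewrite dot4E -![_ *: _]/(_ * _); ring.
Qed.

Lemma Ck_on_dot k (U : set 'rV[R]_4) : open U -> Ck_on k U (fun y => dot y y).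
Proof.
move=> oU; rewrite sqr_dotE.
by do !apply: Ck_onD => //; apply: Ck_onM => //; apply: Ck_on_coord.
Qed.

(* To first order along the sphere, [phi (dot y y)] is constant. *)
Lemma derive_radial (phi : R -> R) (p : 'rV[R]_4 -> R) x v dp :
  dot x x = 1 -> dot v x = 0 -> derivable phi 1 1 -> phi 1 = 1 ->
  is_derive x v p dp -> is_derive x v (fun y => phi (dot y y) * p y) dp.
Proof.
move=> x1 vx /derivable1_diffP dphi phi1 hp.
have dd : differentiable (fun y => dot y y) x.
  by case: (@Ck_on_dot 1%N setT openT) => _ [+ _]; apply.
have dphi' : differentiable phi (dot x x) by rewrite x1.
have hphi : is_derive x v (fun y => phi (dot y y)) 0.
  apply: DeriveDef; first exact/diff_derivable/differentiable_comp.
  rewrite deriveE; last exact: differentiable_comp.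
  rewrite (diff_comp dd dphi') /= -(deriveE _ dd).
  (* By the chain rule the derivative is ['d phi] applied to [2 * dot v x], which is zero in a
     tangent direction. *)
  by rewrite (@derive_val _ _ _ _ _ _ _ (derive_dot x v)) vx mulr0 linear0.
apply: is_derive_eq.
by rewrite x1 phi1 scale1r scaler0 addr0.
Qed.
End RadialMaps.

(** * Derivatives on $\mathbb{S}^3$ of the frame and of the Hopf map *)

Section RoundSphere.
Context {R : realType}.
Implicit Types (x : sphere R) (y z v w : 'rV[R]_4).

Lemma dot_sphere x : dot (val x) (val x) = 1.
Proof. exact/eqP/(valP x). Qed.

Lemma sqr_rad y : y != 0 -> (Num.sqrt (dot y y))^-1 ^+ 2 = (dot y y)^-1.
Proof. by move=> /dot_gt0 y0; rewrite exprVn sqr_sqrtr ?ltW. Qed.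

(** The points of the sphere have a neighbourhood avoiding the origin, where the composite with
    [rad] may be replaced by an explicit formula. *)
Lemma derive_rad (W : normedModType R) (F : sphere R -> W) (G : 'rV[R]_4 -> W)
    x v dG :
  (forall y, y != 0 -> F (Defs.rad y) = G y) -> is_derive (val x) v G dG ->
  deriv_S3 F x v = dG.
Proof.
move=> FG [_ <-]; apply: near_eq_derive.
apply: (@filterS _ _ _ [set y : 'rV[R]_4 | y != 0]) => [y|]; first exact: FG.
exact/open_nbhs_nbhs/(conj open_neq0)/sphere_neq0.
Qed.

(** The frame is linear in the point, so its composite with [rad] is $|y|^{-1}$ times a linear map;
    by [derive_radial] the factor does not contribute in tangent directions. *)
Lemma deriv_frame a x v : tangent x v ->
  deriv_S3 (frame a) x v = qmul v (qimag a).
Proof.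
move=> vx; set q := qimag a.
pose phi (t : R) := (Num.sqrt t)^-1.
have phi1 : phi 1 = 1 by rewrite /phi sqrtr1 invr1.
have dphi : derivable phi 1 1.
  apply: derivableV; first by rewrite sqrtr1 oner_neq0.
  by case: (is_derive1_sqrt (ltr01 : 0 < 1 :> R)).
apply: (@derive_rad _ _ (fun y => quat
    (phi (dot y y) *
      (y 0 0 * q 0 0 - y 0 1 * q 0 1 - y 0 2 * q 0 2 - y 0 3 * q 0 3))
    (phi (dot y y) *
      (y 0 0 * q 0 1 + y 0 1 * q 0 0 + y 0 2 * q 0 3 - y 0 3 * q 0 2))
    (phi (dot y y) *
      (y 0 0 * q 0 2 - y 0 1 * q 0 3 + y 0 2 * q 0 0 + y 0 3 * q 0 1))
    (phi (dot y y) *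
      (y 0 0 * q 0 3 + y 0 1 * q 0 2 - y 0 2 * q 0 1 + y 0 3 * q 0 0)))).
  move=> y y0; rewrite /frame /qmul val_rad // -/(phi _) !mxE -/q.
  by congr quat; ring.
apply: derive_quat; apply: (derive_radial (dot_sphere x) vx dphi phi1);
  apply: is_derive_eq; rewrite -?[_ *: _]/(_ * _); ring.
Qed.

(* [hopf y] is conj(y) i y and [imul y] is i y. *)
Definition hopf y : 'rV[R]_4 :=
  quat 0 (y 0 0 * y 0 0 + y 0 1 * y 0 1 - y 0 2 * y 0 2 - y 0 3 * y 0 3)
    (2 * (y 0 1 * y 0 2 - y 0 0 * y 0 3)) (2 * (y 0 0 * y 0 2 + y 0 1 * y 0 3)).

Definition imul y : 'rV[R]_4 := quat (- y 0 1) (y 0 0) (- y 0 3) (y 0 2).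

(** This is $\bar v i y + \bar y i v$, the differential of the quadratic map [hopf]. *)
Definition dhopf y v : 'rV[R]_4 :=
  quat 0 (2 * (y 0 0 * v 0 0 + y 0 1 * v 0 1 - y 0 2 * v 0 2 - y 0 3 * v 0 3))
    (2 * (v 0 1 * y 0 2 + y 0 1 * v 0 2 - v 0 0 * y 0 3 - y 0 0 * v 0 3))
    (2 * (v 0 0 * y 0 2 + y 0 0 * v 0 2 + v 0 1 * y 0 3 + y 0 1 * v 0 3)).

(** Homogeneity of degree two turns the square root into the factor $|y|^{-2}$. The product with
    zero in the real component is kept so that all four components have the shape expected by
    [derive_radial]. *)
Lemma hopf_rad y : y != 0 -> hopf (val (Defs.rad y)) =
  quat ((dot y y)^-1 * 0)
    ((dot y y)^-1 *
      (y 0 0 * y 0 0 + y 0 1 * y 0 1 - y 0 2 * y 0 2 - y 0 3 * y 0 3))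
    ((dot y y)^-1 * (2 * (y 0 1 * y 0 2 - y 0 0 * y 0 3)))
    ((dot y y)^-1 * (2 * (y 0 0 * y 0 2 + y 0 1 * y 0 3))).
Proof.
by move=> y0; rewrite -sqr_rad // val_rad // /hopf !mxE; congr quat; ring.
Qed.

Lemma deriv_hopf x v : tangent x v ->
  deriv_S3 (fun x => hopf (val x)) x v = dhopf (val x) v.
Proof.
move=> vx; apply: (derive_rad hopf_rad).
have dV : derivable (@GRing.inv R) 1 1.
  by apply: derivableV; [exact: oner_neq0|exact: derivable_id].
apply: derive_quat; apply: (derive_radial (dot_sphere x) vx dV (invr1 _));
  apply: is_derive_eq; rewrite -?[_ *: _]/(_ * _); ring.
Qed.

End RoundSphere.

(** * Smoothness of the fields and the spin connection in the frame *)

Section SpinConnection.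
Context {R : realType}.
Implicit Types (x : sphere R) (y z v w psi : 'rV[R]_4).

Lemma smooth_rad (W : normedModType R) (F : sphere R -> W) (G : 'rV[R]_4 -> W) :
  (forall y, y != 0 -> F (Defs.rad y) = G y) ->
  (forall k, Ck_on k [set y : 'rV[R]_4 | y != 0] G) -> smooth_S3 F.
Proof.
move=> FG hG k; apply: eq_Ck_on open_neq0 _ (hG k) => y.
by rewrite inE /= => /FG ->.
Qed.

Let U := [set y : 'rV[R]_4 | y != 0].

Lemma Ck_on_inv_dot k : Ck_on k U (fun y => (dot y y)^-1).
Proof.
apply: Ck_onV open_neq0 _ (Ck_on_dot k open_neq0) => y /dot_gt0.
exact: lt0r_neq0.
Qed.

(* The binder type ['rV[R]_4] (and not its [NormedModule.sort] form) is what lets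
   the patterns of the tactic [Ck] match. *)
Let CkD k (f g : 'rV[R]_4 -> R) : Ck_on k U f -> Ck_on k U g ->
  Ck_on k U (fun y : 'rV[R]_4 => f y + g y).
Proof. exact: Ck_onD open_neq0. Qed.

Let CkM k (f g : 'rV[R]_4 -> R) : Ck_on k U f -> Ck_on k U g ->
  Ck_on k U (fun y : 'rV[R]_4 => f y * g y).
Proof. exact: Ck_onM open_neq0. Qed.

Let CkN k (f : 'rV[R]_4 -> R) : Ck_on k U f ->
  Ck_on k U (fun y : 'rV[R]_4 => - f y).
Proof. exact: Ck_onN open_neq0. Qed.

Ltac Ck := repeat (lazymatch goal with |- Ck_on _ _ ?f => lazymatch f with
  | fun y => @quat _ _ _ _ _ => apply: (Ck_on_quat open_neq0)
  | fun y => @GRing.inv _ _ => exact: Ck_on_inv_dot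
  | fun y => @Algebra.add _ _ _ => apply: CkD
  | fun y => @Algebra.opp _ _ => apply: CkN
  | fun y => @GRing.mul _ _ _ => apply: CkM
  | fun y => @fun_of_matrix _ _ _ (imul y) _ _ => solve [auto]
  | fun y => @fun_of_matrix _ _ _ y _ _ => exact: (Ck_on_coord _ _ _ open_neq0)
  | fun y => ?c => exact: (Ck_on_cst _ _ c)
  end end).

Lemma smooth_hopf : smooth_S3 (fun x : sphere R => hopf (val x)).
Proof. by apply: smooth_rad hopf_rad _ => k; Ck. Qed.

(** Matrices act on row vectors from the right, and for a unit [y] the product
    [(imul y)^T *m imul y] is the orthogonal projection onto the Hopf direction. *)
Definition endo y : 'M[R]_4 := (3 / 2)%:M - 2 *: ((imul y)^T *m imul y).

Lemma mul_endo v y :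
  v *m endo y = (3 / 2) *: v - (2 * dot v (imul y)) *: imul y.
Proof.
rewrite /endo mulmxBr mul_mx_scalar -scalemxAr mulmxA -[(2 * _) *: _]scalerA.
rewrite (mx11_scalar (v *m _)) mul_scalar_mx; congr (_ - 2 *: (_ *: imul y)).
by rewrite mxE /dot; apply: eq_bigr => i _; rewrite mxE.
Qed.

Lemma smooth_endo : smooth_S3 (fun x : sphere R => endo (val x)).
Proof.
apply: (@smooth_rad _ _ (fun y => \matrix_(i, j) ((3 / 2) *+ (i == j)
   + - (2 * ((dot y y)^-1 * (imul y 0 i * imul y 0 j)))))).
  move=> y y0; rewrite -sqr_rad // val_rad //; set c := (Num.sqrt _)^-1.
  have cy : imul (c *: y) = c *: imul y.
    by apply: quat_eqP; rewrite [RHS]mxE !quatE !mxE ?mulrN.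
  rewrite /endo cy; move: (imul y) => u; apply/matrixP => i j.
  rewrite !mxE big_ord1 !mxE; congr (_ - _); ring.
move=> k; apply: Ck_on_mx open_neq0 _ => i j; rewrite -/U.
(* The index is a variable here, so the entries of [imul y] cannot be unfolded in place; the [auto]
   branch of [Ck] picks up this hypothesis. *)
have hi l : Ck_on k U (fun y => imul y 0 l).
  by elim/ord4P: l; under eq_fun do rewrite quatE; Ck.
by under eq_fun do rewrite mxE; apply: CkD; Ck.
Qed.

Definition tangential w x : 'rV[R]_4 := w - dot w (val x) *: val x.

Lemma dotC n (v w : 'rV[R]_n) : dot v w = dot w v.
Proof. by apply: eq_bigr => i _; rewrite mulrC. Qed.

Lemma dotBl n (v w z : 'rV[R]_n) : dot (v - w) z = dot v z - dot w z.
Proof. by rewrite /dot -sumrB; apply: eq_bigr => i _; rewrite !mxE mulrBl. Qed.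

Lemma dotDl n (v w z : 'rV[R]_n) : dot (v + w) z = dot v z + dot w z.
Proof.
by rewrite /dot -big_split; apply: eq_bigr => i _; rewrite !mxE mulrDl.
Qed.

Lemma dotZl n (c : R) (v w : 'rV[R]_n) : dot (c *: v) w = c * dot v w.
Proof. by rewrite /dot mulr_sumr; apply: eq_bigr => i _; rewrite mxE mulrA. Qed.

(** The Killing equation is stated for global vector fields; projecting constant vectors of
    $\mathbb{R}^4$ yields a field with any prescribed tangent value at a given point. *)
Lemma vector_field_tangential w : vector_field (tangential w).
Proof.
split=> [|x]; last first.
  by rewrite /tangent /tangential dotBl dotZl dot_sphere mulr1 subrr.
apply: (@smooth_rad _ _ (fun y => \row_j (w 0 j
  + - (((dot y y)^-1 * (w 0 0 * y 0 0 + w 0 1 * y 0 1 + w 0 2 * y 0 2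
                        + w 0 3 * y 0 3)) * y 0 j)))).
  move=> y y0; apply/rowP => i; rewrite /tangential -sqr_rad// val_rad // !mxE.
  by rewrite dot4E !mxE; congr (_ - _); ring.
move=> k; apply: Ck_on_mx open_neq0 _ => i j; rewrite ord1 -/U.
by under eq_fun do rewrite mxE; apply: CkD; Ck.
Qed.

Lemma big_ord3 (W : nmodType) (F : 'I_3 -> W) :
  \sum_(i < 3) F i = F 0 + F 1 + F 2.
Proof.
rewrite !big_ord_recl big_ord0 addr0 !addrA.
by congr (_ + F _ + F _); apply/val_inj.
Qed.

Lemma frameE x : let y := val x in
  [/\ frame 0 x = quat (- y 0 1) (y 0 0) (y 0 3) (- y 0 2),
      frame 1 x = quat (- y 0 2) (- y 0 3) (y 0 0) (y 0 1) &
      frame 2 x = quat (- y 0 3) (y 0 2) (- y 0 1) (y 0 0)].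
Proof.
by split; rewrite /frame /qmul /qimag !mxE /=; apply: quat_eqP; rewrite !quatE;
  ring.
Qed.

Lemma cliffordE x v psi :
  let t a := dot v (frame a x) in
  clifford x v psi =
  quat (t 0 * psi 0 1 + t 1 * psi 0 2 + t 2 * psi 0 3)
       (- (t 0 * psi 0 0) - t 1 * psi 0 3 + t 2 * psi 0 2)
       (t 0 * psi 0 3 - t 1 * psi 0 0 - t 2 * psi 0 1)
       (- (t 0 * psi 0 2) + t 1 * psi 0 1 - t 2 * psi 0 0).
Proof.
move=> t; have [g0 g1 g2] := gammaE psi.
rewrite /clifford big_ord3 g0 g1 g2 -/(t 0) -/(t 1) -/(t 2).
move: (t 0) (t 1) (t 2) => t0 t1 t2.
by apply: quat_eqP; rewrite !mxE /=; ring.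
Qed.

Lemma cliffordZl x (c : R) v psi :
  clifford x (c *: v) psi = c *: clifford x v psi.
Proof.
by rewrite /clifford scaler_sumr; apply: eq_bigr => a _; rewrite dotZl scalerA.
Qed.

(** The normal correction in the Levi-Civita connection is orthogonal to the frame. *)
Lemma dot_levi_civita_frame a b x v : tangent x v ->
  dot (levi_civita x v (frame a)) (frame b x) =
  dot (qmul v (qimag a)) (frame b x).
Proof.
move=> vx; have := frame_tangent b x.
rewrite /levi_civita deriv_frame // /tangent.
by rewrite dotC dotBl dotZl => ->; rewrite mulr0 subr0.
Qed.

(** With $t_c = \langle v, e_c\rangle$ the connection coefficients are $K_{ab} = \sum_c
    \varepsilon_{abc} t_c$. Since the volume form acts as $1$, one has $e_0 e_1 = -e_2$ and its
    cyclic analogues, so $\frac14 \sum K_{ab} e_a e_b = -\frac12 v$. *)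
Lemma spin_nablaE x v (Psi : sphere R -> 'rV[R]_4) : tangent x v ->
  spin_nabla x v Psi = deriv_S3 Psi x v - 2^-1 *: clifford x v (Psi x).
Proof.
move=> vx; pose K a b := dot (qmul v (qimag a)) (frame b x).
pose t a := dot v (frame a x).
rewrite /spin_nabla; congr (_ + _).
transitivity (4^-1 *: \sum_(a < 3) \sum_(b < 3)
    K a b *: Defs.gamma a (Defs.gamma b (Psi x))).
  congr (_ *: _); apply: eq_bigr => a _; apply: eq_bigr => b _.
  by rewrite (dot_levi_civita_frame _ _ vx) !clifford_frame.
have [e0 e1 e2] := frameE x.
have q a : qmul v (qimag a) = quat
  (- (v 0 1 * (a == 0)%:R + v 0 2 * (a == 1)%:R + v 0 3 * (a == 2)%:R))
  (v 0 0 * (a == 0)%:R - v 0 3 * (a == 1)%:R + v 0 2 * (a == 2)%:R)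
  (v 0 3 * (a == 0)%:R + v 0 0 * (a == 1)%:R - v 0 1 * (a == 2)%:R)
  (- (v 0 2 * (a == 0)%:R) + v 0 1 * (a == 1)%:R + v 0 0 * (a == 2)%:R).
  by elim/ord3P: a; rewrite /qmul /qimag !mxE /=; congr quat; ring.
(* Right multiplication by a unit is an isometry, so [K a a] equals [dot v (val x)]. *)
have L00 a : K a a = 0.
  rewrite -[RHS]vx /K q.
  by elim/ord3P: a; rewrite ?(e0, e1, e2) !dot4E !quatE /=; ring.
(* Likewise $\langle vi, xj\rangle = \langle v, xji^{-1}\rangle = \langle v, xk\rangle$; the other
   five coefficients are similar. *)
have L01 : K 0 1 = t 2.
  by rewrite /K /t e1 e2 q !dot4E !quatE /=; ring.
have L10 : K 1 0 = - t 2.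
  by rewrite /K /t e0 e2 q !dot4E !quatE /=; ring.
have L12 : K 1 2 = t 0.
  by rewrite /K /t e0 e2 q !dot4E !quatE /=; ring.
have L21 : K 2 1 = - t 0.
  by rewrite /K /t e0 e1 q !dot4E !quatE /=; ring.
have L20 : K 2 0 = t 1.
  by rewrite /K /t e0 e1 q !dot4E !quatE /=; ring.
have L02 : K 0 2 = - t 1.
  by rewrite /K /t e1 e2 q !dot4E !quatE /=; ring.
rewrite cliffordE -/(t 0) -/(t 1) -/(t 2) !big_ord3.
clearbody K t; rewrite !L00 L01 L10 L12 L21 L20 L02 !scale0r add0r !addr0.
move: (Psi x) (t 0) (t 1) (t 2) => psi t0 t1 t2.
have G0 (p : 'rV[R]_4) := let: And3 h _ _ := gammaE p in h.
have G1 (p : 'rV[R]_4) := let: And3 _ h _ := gammaE p in h.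
have G2 (p : 'rV[R]_4) := let: And3 _ _ h := gammaE p in h.
rewrite !(G0, G1, G2) !quatE.
by apply: quat_eqP; rewrite !mxE /=; field.
Qed.

End SpinConnection.

(** * The Hopf spinor and its generalized Killing equation *)

Section HopfSpinor.
Context {R : realType}.
Implicit Types (x : sphere R) (y z v w psi : 'rV[R]_4).

Lemma tangent_decomp x v : tangent x v ->
  v = dot v (frame 0 x) *: frame 0 x + dot v (frame 1 x) *: frame 1 x +
      dot v (frame 2 x) *: frame 2 x.
Proof.
move=> vx; have x1 := dot_sphere x; have [-> -> ->] := frameE x.
move: vx x1; rewrite /tangent; move: (val x) => y vx y1.
(* Written this way, the expansion becomes a polynomial identity in [y] and [v], valid without the
   constraints, which [ring] can check. *)
have E : v = dot y y *: v - dot v y *: y by rewrite vx y1 scale1r scale0r subr0.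
rewrite [LHS]E !dot4E !quatE.
by apply: quat_eqP; rewrite !mxE /=; ring.
Qed.

(** Multiplicativity of the quaternion norm gives $|\bar y i y|^2 = |y|^4$. *)
Lemma dot_hopf_hopf x : dot (hopf (val x)) (hopf (val x)) = 1.
Proof.
transitivity (dot (val x) (val x) ^+ 2); last by rewrite dot_sphere expr1n.
by rewrite !dot4E !quatE; ring.
Qed.

(** From $\langle iy, ye\rangle = \langle \bar y i y, e\rangle$: the spinor consists of the
    components of the Hopf field in the frame. *)
Lemma dot_imul_frame x : [/\ dot (imul (val x)) (frame 0 x) = hopf (val x) 0 1,
  dot (imul (val x)) (frame 1 x) = hopf (val x) 0 2 &
  dot (imul (val x)) (frame 2 x) = hopf (val x) 0 3].
Proof.
by have [-> -> ->] := frameE x; split; rewrite dot4E !quatE; ring.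
Qed.

Lemma tangent_imul x : tangent x (imul (val x)).
Proof. by rewrite /tangent dot4E !quatE; ring. Qed.

(** Write $v = xt$ with $t$ imaginary and $\psi = \bar x i x$. Then $d\Psi(v) = \psi t - t\psi =
    2\,\psi\times t$, while $v\cdot\psi = -t\psi = \langle t,\psi\rangle + \psi\times t$ and
    $\xi\cdot\psi = -\psi^2 = 1$. Hence $d\Psi(v) = 2\,v\cdot\psi - 2\langle
    v,\xi\rangle\,\xi\cdot\psi$, and the connection term subtracts $\frac12 v\cdot\psi$. *)
Lemma spin_nabla_hopf x v : tangent x v ->
  spin_nabla x v (fun x => hopf (val x)) =
  clifford x (v *m endo (val x)) (hopf (val x)).
Proof.
move=> vx; rewrite spin_nablaE // deriv_hopf //.
have vE := tangent_decomp vx; rewrite !cliffordE mul_endo !dotBl !dotZl.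
have [h0 h1 h2] := dot_imul_frame x; rewrite h0 h1 h2.
set t0 := dot v (frame 0 x) in vE *; set t1 := dot v (frame 1 x) in vE *.
set t2 := dot v (frame 2 x) in vE *.
have -> : dot v (imul (val x)) =
    t0 * hopf (val x) 0 1 + t1 * hopf (val x) 0 2 + t2 * hopf (val x) 0 3.
  by rewrite [in LHS]vE !dotDl !dotZl ![dot (frame _ x) _]dotC h0 h1 h2.
(* This is the cross product $2\,\psi\times t$ in coordinates. *)
have -> : dhopf (val x) v = quat 0
   (2 * (hopf (val x) 0 2 * t2 - hopf (val x) 0 3 * t1))
   (2 * (hopf (val x) 0 3 * t0 - hopf (val x) 0 1 * t2))
   (2 * (hopf (val x) 0 1 * t1 - hopf (val x) 0 2 * t0)).
  have [f0 f1 f2] := frameE x; rewrite f0 f1 f2 in vE.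
  move: (t0) (t1) (t2) vE => s0 s1 s2 ->.
  move: (val x) => y; rewrite /dhopf.
  by apply: quat_eqP; rewrite !quatE // !mxE /=; ring.
have := dot_hopf_hopf x; rewrite dot4E.
have -> : hopf (val x) 0 0 = 0 by exact: quat0.
rewrite mul0r add0r; move: (hopf _ 0 1) (hopf _ 0 2) (hopf _ 0 3) => a b c hh.
move: (t0) (t1) (t2) => s0 s1 s2.
apply: quat_eqP; rewrite mxE [in X in _ + X]mxE [in X in _ + X]mxE !quatE.
(* The real component is the one that uses $|\psi| = 1$, which reduces the coefficient of $\langle
   t,\psi\rangle$ to $\frac32 - 2 = -\frac12$. *)
- transitivity (3 / 2 * (s0 * a + s1 * b + s2 * c) -
    2 * (s0 * a + s1 * b + s2 * c) * (a * a + b * b + c * c)).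
    by rewrite hh; field.
  by field.
- by field.
- by field.
- by field.
Qed.

Lemma symmetric_endo : symmetric_endo_field (fun x : sphere R => endo (val x)).
Proof.
split; first exact: smooth_endo.
  move=> z v vz; rewrite /tangent mul_endo dotBl !dotZl.
  by rewrite (vz : dot _ _ = 0) (tangent_imul z : dot _ _ = 0) !mulr0 subr0.
move=> z v w _ _; rewrite !mul_endo [RHS]dotC !dotBl !dotZl.
by rewrite [dot w v]dotC ![dot (imul _) _]dotC; ring.
Qed.

Lemma hopf_pole : hopf (val (pole R)) = quat 0 1 0 0.
Proof. by apply: quat_eqP; rewrite /= !quatE; ring. Qed.

End HopfSpinor.

Theorem mainTheorem4 (R : realType) :
  exists Psi : sphere R -> 'rV[R]_4,
    generalized_killing_spinor Psi /\ ~ killing_spinor Psi.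
Proof.
exists (fun x => hopf (val x)); split.
  exists (fun x => endo (val x)); split.
  - exact: smooth_hopf.
  - exists (pole R); rewrite hopf_pole; apply/eqP => /rowP/(_ 1).
    by rewrite quat1 mxE => /eqP; rewrite oner_eq0.
  - exact: symmetric_endo.
  - by move=> X [_ tX] x; exact: spin_nabla_hopf (tX x).
case=> A [_ _ _ AE] [l _ Al].
pose p := pole R; pose psi := hopf (val p).
(* Comparing the two Killing equations along a field through [frame a p] gives $(c -
   l)\,e_a\cdot\psi = 0$. *)
have eigenvalue_eq a c : frame a p *m endo (val p) = c *: frame a p -> c = l.
  move=> fc; have ta := frame_tangent a p.
  have := AE _ (vector_field_tangential (frame a p)) p.
  have -> : tangential (frame a p) p = frame a p.
    by rewrite /tangential (ta : dot _ _ = 0) scale0r subr0.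
  rewrite (spin_nabla_hopf ta) fc (Al _ _ ta) !cliffordZl clifford_frame.
  move=> /eqP.
  rewrite -subr_eq0 -scalerBl scaler_eq0 subr_eq0 => /orP[/eqP//|/eqP g0].
  (* Skew-symmetry and $e_a^2 = -1$ give $|e_a\cdot\psi|^2 = |\psi|^2 = 1$, so the product cannot
     vanish. *)
  have := gamma_skew a psi (Defs.gamma a psi).
  have -> : dot psi (Defs.gamma a (Defs.gamma a psi)) = -1.
    by rewrite gammaK dotC -scaleN1r dotZl dot_hopf_hopf mulr1.
  rewrite g0 -[X in dot X _](scale0r 0) dotZl mul0r opprK => /eqP.
  by rewrite eq_sym oner_eq0.
(* At the pole $1$ the Hopf field is $i$, that is [frame 0 p], and [frame 1 p] is orthogonal to it;
   the two eigenvalues would both equal [l]. *)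
have [f0 f1 _] := frameE p.
have /eigenvalue_eq l1 : frame 1 p *m endo (val p) = (3 / 2) *: frame 1 p.
  rewrite mul_endo f1 dot4E /= !quatE !(mul0r, mulr0, addr0, oppr0).
  by rewrite scale0r subr0.
have /eigenvalue_eq : frame 0 p *m endo (val p) = (3 / 2 - 2) *: frame 0 p.
  have i0 : imul (val p) = frame 0 p by rewrite f0 /imul /= !quatE oppr0.
  by rewrite mul_endo i0 frame_orthonormal mulr1 -scalerBl.
by rewrite -l1 => /eqP; rewrite -subr_eq0 addrAC subrr add0r oppr_eq0 pnatr_eq0.
Qed.
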